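(* Let $E$ be a real Banach space which is uniformly convex with modulus $\delta_E$, and let $d>0$. Let $A\subset E$ be a nonempty closed set which is weakly convex with modulus of nonconvexity $\gamma_A(\varepsilon)$, $\varepsilon\in[0,2d)$, with $d\,\delta_E(\varepsilon/d)>\gamma_A(\varepsilon)$ for all $\varepsilon\in(0,2d)$, and suppose condition (i) holds for $\delta(t)=d\,\delta_E(t/d)$ and $\gamma=\gamma_A$. Suppose further that $A\subset B_r(a)$ for some $a\in E$ and $r>0$ with $2r<d$, and that $\gamma_A(\varepsilon)<d\,\delta_E(\varepsilon/d)$ for all $\varepsilon\in(0,\operatorname{diam}A)$. Then $A$ is a continuous retract of $E$, i.e. there is a continuous map $\phi:E\to A$ with $\phi(x)=x$ for all $x\in A$.
   Context: $B_r(a)$ is the closed ball. $\delta_E(\varepsilon)=\sup\{\delta\ge0: B_\delta(\frac{x_1+x_2}{2})\subset B_1(0)\ \forall x_1,x_2\in B_1(0),\ \|x_1-x_2\|=\varepsilon\}$ on $[0,2)$; $E$ uniformly convex means $\delta_E>0$ on $(0,2)$. For closed $A$ and $\varepsilon>0$, $\gamma^0_A(\varepsilon)=\inf\{\gamma>0: B_\gamma(\frac{x_1+x_2}{2})\cap A\ne\emptyset\ \forall x_1,x_2\in A,\ \|x_1-x_2\|\le\varepsilon\}$; modulus of nonconvexity $\gamma_A(0)=0$, $\gamma_A(\varepsilon)=\lim_{\tau\downarrow\varepsilon}\gamma^0_A(\tau)$. $A$ is weakly convex with modulus $\gamma_A$ on $[0,d')$ if $\gamma_A(\varepsilon)<\varepsilon/2$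 for $\varepsilon\in(0,d')$. Condition (i) for moduli $\delta,\gamma$: there is $s_0>0$ such that for every $s\in(0,s_0]$: (1) there is $t_s>s$ with $\delta(t_s-s)=\gamma(t_s)$; (2) $t\mapsto\delta(t-s)-\gamma(t)$ is positive and increasing for $t>t_s$; (3) there is $t(s)>t_s$ with $\delta(t(s)-s)-\gamma(t(s))=s/2$. *)

(* Defs.v *)
From HB Require Import structures.
From mathcomp Require Import all_boot all_order all_algebra.
From mathcomp Require Import all_classical all_reals all_analysis.
Set Implicit Arguments. Unset Strict Implicit. Unset Printing Implicit Defensive.
Import Order.TTheory GRing.Theory Num.Theory.
Import numFieldNormedType.Exports.
Local Open Scope classical_set_scope.
Local Open Scope ring_scope.

Section Defs.
Context {R : realType} {E : normedModType R}.

Definition cball (a : E) (r : R) : set E := [set y | `|y - a| <= r].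

(* modulus of convexity delta_E on [0,2) (given by the same formula everywhere) *)
Definition modconv (eps : R) : R :=
  sup [set del : R | 0 <= del /\
        forall x1 x2 : E, cball 0 1 x1 -> cball 0 1 x2 -> `|x1 - x2| = eps ->
          cball (2%:R^-1 *: (x1 + x2)) del `<=` cball 0 1].

Definition uniformly_convex : Prop :=
  forall eps : R, 0 < eps < 2%:R -> 0 < modconv eps.

Definition gamma0 (A : set E) (eps : R) : R :=
  inf [set g : R | 0 < g /\
        forall x1 x2 : E, A x1 -> A x2 -> `|x1 - x2| <= eps ->
          cball (2%:R^-1 *: (x1 + x2)) g `&` A !=set0].

Definition modnonconv (A : set E) (eps : R) : R :=
  if eps == 0 then 0 else lim (gamma0 A @ eps^'+).

Definition weakly_convex (A : set E) (d' : R) : Prop :=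
  forall eps : R, 0 < eps < d' -> modnonconv A eps < eps / 2%:R.

Definition diam (A : set E) : R := sup [set `|x - y| | x in A & y in A].

End Defs.

(* condition (i) for moduli delta, gamma defined on [0, D) *)
Definition condition_i {R : realType} (delta gamma : R -> R) (D : R) : Prop :=
  exists2 s0 : R, 0 < s0 & forall s : R, 0 < s <= s0 ->
    exists ts : R, [/\ s < ts,
      delta (ts - s) = gamma ts,
      (forall t t' : R, ts < t -> t < t' -> t' < D ->
          delta (t - s) - gamma t < delta (t' - s) - gamma t'),
      (forall t : R, ts < t -> t < D -> 0 < delta (t - s) - gamma t) &
      exists ts' : R, [/\ ts < ts', ts' < D &
          delta (ts' - s) - gamma ts' = s / 2%:R]].

(* Main.v *)
Require Import Defs.
From HB Require Import structures.
From mathcomp Require Import all_boot all_order all_algebra.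
From mathcomp Require Import all_classical all_reals all_analysis.
From mathcomp Require Import lra.
Import Order.TTheory GRing.Theory Num.Theory.
Import numFieldNormedType.Exports.
Local Open Scope classical_set_scope.
Local Open Scope ring_scope.

(** The retraction is the radial retraction onto [cball a r] followed by the
metric projection onto [A]. If [x1], [x2] in [A] nearly realise the distance
[D < d] from [x] to [A] and [`|x1 - x2|] is close to [e], then the midpoint of
[x1] and [x2] lies within about [D - d * modconv (e / d)] of [x], while a point
of [A] lies within about [modnonconv A e] of the midpoint; as [modnonconv A e <
d * modconv (e / d)], this point is closer to [x] than [D], a contradiction.
Compactness of the range of [e] makes this uniform: near-minimizers of the
distance are close to each other. Hence the projection exists, is unique and
depends continuously on [x]. *)

(** * Midpoint estimates in balls of varying radius *)

Section ModulusOfConvexity.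
Context {R : realType} {E : normedModType R}.
Implicit Types (x y m w : E) (d e rho : R).

(** The direction is radial, [m] normalised; [w] supplies a unit vector when [m = 0]. *)
Lemma exists_unit_direction m w : w != 0 ->
  exists u : E, `|u| = 1 /\ forall t : R, 0 <= t -> `|m + t *: u| = `|m| + t.
Proof.
move=> w0; have [->|m0] := eqVneq m 0.
  have nw : `|(`|w|^-1 *: w)| = 1.
    by rewrite normrZ normrV ?unitfE ?normr_eq0// normr_id mulVf ?normr_eq0.
  by exists (`|w|^-1 *: w); split => // t t0; rewrite add0r normr0 add0r normrZ nw mulr1 ger0_norm.
exists (`|m|^-1 *: m).
have nm : `|(`|m|^-1 *: m)| = 1.
  by rewrite normrZ normrV ?unitfE ?normr_eq0// normr_id mulVf ?normr_eq0.
split => // t t0.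
rewrite -{1}[m](scalerKV (a := `|m|)) ?normr_eq0// -scalerDl normrZ nm mulr1.
by rewrite ger0_norm// addr_ge0.
Qed.

(** If the ball of radius [del] about the midpoint lies in the unit ball, so does its point radially
    farthest from the origin, which bounds [del] by 1 minus the norm of the midpoint. The supremum
    over [del] obeys the same bound. *)
Lemma midpoint_modconv x y : `|x| <= 1 -> `|y| <= 1 -> x != y ->
  `|2%:R^-1 *: (x + y)| <= 1 - modconv (E := E) `|x - y|.
Proof.
move=> x1 y1 xy.
have mid (x' y' : E) : `|x'| <= 1 -> `|y'| <= 1 -> `|2%:R^-1 *: (x' + y')| <= 1.
  move=> ? ?; rewrite normrZ ger0_norm ?invr_ge0 ?ler0n//.
  have := ler_normD x' y'; lra.
rewrite lerBrDr addrC -lerBrDr; apply: ge_sup.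
  exists 0; split => // x' y'; rewrite /cball/= !subr0 => ? ? _ z /=.
  rewrite normr_le0 subr_eq0 => /eqP ->; rewrite subr0; exact: mid.
move=> del [del0 /(_ x y)]; rewrite /cball/= !subr0 => /(_ x1 y1 erefl) sub.
have [u [u1 mu]] := exists_unit_direction (2%:R^-1 *: (x + y)) (x - y) ltac:(by rewrite subr_eq0).
have := sub (2%:R^-1 *: (x + y) + del *: u).
rewrite /= addrAC subrr add0r subr0 normrZ u1 mulr1 ger0_norm// lexx => /(_ isT).
by rewrite mu// => ?; rewrite lerBrDr addrC.
Qed.

Lemma midpoint_modconv_scaled d (c x y : E) : 0 < d ->
  `|x - c| <= d -> `|y - c| <= d -> x != y ->
  `|2%:R^-1 *: (x + y) - c| <= d - d * modconv (E := E) (`|x - y| / d).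
Proof.
move=> d0 xc yc xy.
have dV : `|d^-1| = d^-1 by rewrite ger0_norm// invr_ge0 ltW.
have := @midpoint_modconv (d^-1 *: (x - c)) (d^-1 *: (y - c)).
rewrite [`|d^-1 *: (x - c)|]normrZ [`|d^-1 *: (y - c)|]normrZ dV.
rewrite !ler_pdivrMl// !mulr1 => /(_ xc yc).
have -> : d^-1 *: (x - c) != d^-1 *: (y - c).
  apply: contra xy => /eqP /(scalerI _) H; apply/eqP; apply: (addIr (- c)); apply: H.
  by rewrite invr_eq0 gt_eqF.
have -> : d^-1 *: (x - c) - d^-1 *: (y - c) = d^-1 *: (x - y).
  by rewrite -scalerBr opprD addrACA subrr addr0.
have -> : 2%:R^-1 *: (d^-1 *: (x - c) + d^-1 *: (y - c)) =
          d^-1 *: (2%:R^-1 *: (x + y) - c).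
  rewrite -scalerDr scalerA mulrC -scalerA addrACA scalerDr -opprD -mulr2n -(scaler_nat 2 c).
  by rewrite scalerN scalerA mulVf ?pnatr_eq0// scale1r.
by move=> /(_ isT); rewrite !normrZ dV ler_pdivrMl// mulrBr mulr1 (mulrC d^-1).
Qed.

(* The ball of radius [rho] is contained in the ball of radius [d] translated by [d - rho] away from the midpoint. *)
Lemma midpoint_modconv_smaller d rho (c x y : E) : 0 < d -> rho <= d ->
  `|x - c| <= rho -> `|y - c| <= rho -> x != y ->
  `|2%:R^-1 *: (x + y) - c| <= rho - d * modconv (E := E) (`|x - y| / d).
Proof.
move=> d0 rd xc yc xy.
have [u [u1 mu]] :=
  exists_unit_direction (2%:R^-1 *: (x + y) - c) (x - y) ltac:(by rewrite subr_eq0).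
have rd0 : 0 <= d - rho by rewrite subr_ge0.
have far z : `|z - c| <= rho -> `|z - (c - (d - rho) *: u)| <= d.
  move=> zc; rewrite opprB addrCA addrC (le_trans (ler_normD _ _))//.
  by rewrite [X in _ + X]normrZ u1 mulr1 ger0_norm//; lra.
have := @midpoint_modconv_scaled d _ x y d0 (far x xc) (far y yc) xy.
rewrite opprB addrCA addrC mu//; lra.
Qed.

End ModulusOfConvexity.

(** * The right limit of [gamma0] as an infimum *)

Section ModulusOfNonconvexity.
Context {R : realType} {E : normedModType R}.
Variable A : set E.

Let G (e : R) := [set g : R | 0 < g /\
        forall x1 x2 : E, A x1 -> A x2 -> `|x1 - x2| <= e ->
          cball (2%:R^-1 *: (x1 + x2)) g `&` A !=set0].

(** The radius [e] is admissible, since [x1] itself lies within [e / 2] of the midpoint. *)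
Lemma has_inf_gamma0 (e : R) : 0 < e -> has_inf (G e).
Proof.
move=> e0; split; last by exists 0 => g [/ltW].
exists e; split => // x1 x2 A1 A2 le_e; exists x1; split => //; rewrite /cball/=.
rewrite -{1}[x1](scale1r x1) -{1}(@mulVf R 2%:R) ?pnatr_eq0// -scalerA -scalerBr normrZ.
rewrite scaler_nat (mulr2n x1) addrKA ger0_norm ?invr_ge0 ?ler0n//; lra.
Qed.

(** As [gamma0 A] is nondecreasing and bounded below, its right limit at [e] is its infimum over
    [tau > e]. The strict [e < tau] leaves room for pairs slightly more than [e] apart. *)
Lemma modnonconv_lt (e c : R) : 0 < e -> modnonconv A e < c ->
  exists2 tau, e < tau & exists2 g, g < c & G tau g.
Proof.
move=> e0; rewrite /modnonconv gt_eqF//.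
have cv : gamma0 A x @[x --> e^'+] -->
    inf [set gamma0 A x | x in [set` Interval (BRight e) +oo%O]].
  apply: nondecreasing_at_right_cvgr => //.
    move=> s t; rewrite !in_itv/= !andbT => es et st.
    apply: lb_le_inf; first by case: (has_inf_gamma0 t (lt_trans e0 et)).
    move=> g [g0 gt]; apply: ge_inf; first by case: (has_inf_gamma0 s (lt_trans e0 es)).
    by split => // x1 x2 A1 A2 /le_trans /(_ st); exact: gt.
  exists 0 => _ [t + <-]; rewrite /= in_itv/= andbT => et.
  apply: lb_le_inf; first by case: (has_inf_gamma0 t (lt_trans e0 et)).
  by move=> h [/ltW].
rewrite (cvg_lim _ cv)// => /inf_lt [].
  by exists (gamma0 A (e + 1)); exists (e + 1) => //=; rewrite in_itv/= andbT ltrDl.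
move=> _ [tau + <-]; rewrite /= in_itv/= andbT => et /inf_lt [].
  by case: (has_inf_gamma0 tau (lt_trans e0 et)).
by move=> g Gg gc; exists tau => //; exists g.
Qed.

End ModulusOfNonconvexity.

(** * Distance to a set, near-minimizers and the metric projection *)

Definition dist_to {R : realType} {E : normedModType R} (A : set E) (x : E) : R :=
  inf [set `|y - x| | y in A].

Section MetricProjection.
Context {R : realType} {E : normedModType R}.
Variable A : set E.

Lemma dist_to_le x y : A y -> dist_to A x <= `|y - x|.
Proof. by move=> Ay; apply: ge_inf; [exists 0 => _ [z _ <-] | exists y]. Qed.

Lemma dist_to_adherent x (eta : R) : A !=set0 -> 0 < eta ->
  exists2 y, A y & `|y - x| < dist_to A x + eta.
Proof.
move=> [y Ay] eta0; have [|_ [z Az <-] zx] := @inf_adherent _ [set `|y - x| | y in A] _ eta0.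
  by split; [exists `|y - x|, y | exists 0 => _ [z _ <-]].
by exists z.
Qed.

Lemma dist_to_lip x y : A !=set0 -> dist_to A x <= dist_to A y + `|x - y|.
Proof.
move=> A0; apply/ler_addgt0Pr => eta eta0.
have [z Az zy] := @dist_to_adherent y _ A0 eta0.
have := dist_to_le x z Az; have := ler_distD y z x; rewrite (distrC y x); lra.
Qed.

Definition near_minimizer (x : E) (eta : R) (y : E) :=
  A y /\ `|y - x| <= dist_to A x + eta.

(** The joint neighbourhood in [e'] and [eta] is the local form that compactness makes uniform. Both
    moduli are compared at [e] only, so no continuity of [modconv] enters. *)
Lemma near_minimizers_gap (d rho e : R) :
  0 < d -> rho < d -> 0 < e -> modnonconv A e < d * modconv (E := E) (e / d) ->
  \forall e' \near e & eta \near 0^'+, forall x x1 x2, dist_to A x <= rho ->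
    near_minimizer x eta x1 -> near_minimizer x eta x2 -> `|x1 - x2| <> e'.
Proof.
move=> d0 rd e0; set D := d * _ => eD.
pose c := (modnonconv A e + D) / 2; have cD : c < D by rewrite /c; lra.
have /(@modnonconv_lt _ _ _ _ _ e0) [tau etau [g gc [_ Gg]]] : modnonconv A e < c.
  by rewrite /c; lra.
(* In order, the bounds keep the total error [eta + 3 b / 2] below [D - c], the enlarged radius
   [dist_to A x + eta + b] at most [d], [e'] below [tau], and [e'] positive. *)
pose k := Num.min (Num.min ((D - c) / 3) ((d - rho) / 2)) (Num.min (tau - e) e).
have k0 : 0 < k by rewrite !lt_min -andbA; apply/and4P; split; lra.
have [k1 k2 k3 k4] : [/\ k <= (D - c) / 3, k <= (d - rho) / 2, k <= tau - e & k <= e].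
  by split; rewrite !ge_min lexx ?orbT.
exists (ball e k, [set eta | 0 < eta < k]).
  split => /=; first exact: nbhsx_ballx.
  near=> eta; apply/andP; split.
    by near: eta; exact: nbhs_right_gt.
  by near: eta; exact: nbhs_right_lt.
move=> [e' eta] /= [/=]; rewrite /ball/= => ee' /andP[eta0 etak] x x1 x2 xrho [A1 x1x] [A2 x2x] xx.
pose b := `|e - e'|; have b0 : 0 <= b by exact: normr_ge0.
have bk : b < k by exact: ee'.
have e'0 : 0 < e' by have := ler_norm (e - e'); lra.
(* moving [x2] along the line through [x1] to distance exactly [e] *)
pose y := x1 + (e / e') *: (x2 - x1).
have x1y : `|x1 - y| = e.
  rewrite /y opprD addrA subrr sub0r normrN normrZ distrC xx ger0_norm ?divr_ge0 ?ltW//.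
  by rewrite divfK// gt_eqF.
have yE : y - x2 = (e / e' - 1) *: (x2 - x1).
  by rewrite scalerBl scale1r opprB addrA /y (addrC x1).
have yx2 : `|y - x2| = b.
  rewrite yE normrZ (distrC x2) xx -[X in _ * X = _](gtr0_norm e'0) -normrM mulrBl mul1r.
  by rewrite divfK// gt_eqF.
have x1x' : `|x1 - x| <= dist_to A x + eta + b by lra.
have yx' : `|y - x| <= dist_to A x + eta + b.
  by have := ler_distD x2 y x; rewrite yx2; lra.
have x1y0 : x1 != y by rewrite -subr_eq0 -normr_gt0 x1y.
have := @midpoint_modconv_smaller _ _ d _ x x1 y d0 _ x1x' yx' x1y0.
rewrite x1y -/D => /(_ ltac:(lra)) mid'.
(* Since [y] may lie outside [A], the point [z] is taken near the midpoint of [x1] and [x2], at the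
   cost of the shift [b / 2] between the two midpoints. *)
have [|z [zm Az]] := Gg x1 x2 A1 A2.
  by rewrite xx; have := ler_norm (e' - e); rewrite distrC; lra.
have mm' : `|2%:R^-1 *: (x1 + x2) - 2%:R^-1 *: (x1 + y)| = b / 2%:R.
  rewrite -scalerBr opprD addrACA subrr add0r normrZ distrC yx2 mulrC.
  by rewrite ger0_norm// invr_ge0.
have := ler_distD (2%:R^-1 *: (x1 + y)) (2%:R^-1 *: (x1 + x2)) x.
have := ler_distD (2%:R^-1 *: (x1 + x2)) z x.
have := dist_to_le x z Az; move: zm; rewrite /cball/= mm'; lra.
Unshelve. all: by end_near. Qed.

(** A pair at distance at least [e] would have its distance in the compact segment from [e] to [M],
    where one [eta] excludes every value. This [eta] is common to all [x], which later gives
    continuity as well as existence. *)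
Lemma near_minimizers_close (d rho M : R) :
  0 < d -> rho < d -> (forall x y, A x -> A y -> `|x - y| <= M) ->
  (forall e, 0 < e <= M -> modnonconv A e < d * modconv (E := E) (e / d)) ->
  forall e, 0 < e -> exists2 eta, 0 < eta & forall x x1 x2, dist_to A x <= rho ->
    near_minimizer x eta x1 -> near_minimizer x eta x2 -> `|x1 - x2| < e.
Proof.
move=> d0 rd AM gap e e0.
have /compact_near_coveringP/(_ R 0^'+ (fun eta e' => forall x x1 x2, dist_to A x <= rho ->
    near_minimizer x eta x1 -> near_minimizer x eta x2 -> `|x1 - x2| <> e')) := @segment_compact R e M.
move=> /(_ _ _)[] => [t|].
  rewrite /= in_itv/= => /andP[et tM]; apply: (near_minimizers_gap d) => //.
    exact: lt_le_trans et.
  by apply: gap; rewrite tM (lt_le_trans e0).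
move=> k /= k0 H.
exists (k / 2); first by rewrite divr_gt0.
move=> x x1 x2 xrho n1 n2; rewrite ltNge; apply/negP => ex.
apply: (H (k / 2) _ _ `|x1 - x2| _ x x1 x2 xrho n1 n2 erefl).
- rewrite /ball/= sub0r normrN gtr0_norm ?divr_gt0//; lra.
- by rewrite divr_gt0.
- by rewrite /= in_itv/= ex; apply: AM; [case: n1|case: n2].
Qed.

End MetricProjection.

(** A minimizing sequence is eventually made of [eta]-near minimizers for each [eta], hence is
    Cauchy; its limit stays in the closed set [A]. *)
Lemma exists_projection {R : realType} {E : completeNormedModType R} (A : set E) (x : E) :
  closed A -> A !=set0 ->
  (forall e : R, 0 < e -> exists2 eta, 0 < eta & forall x1 x2,
     near_minimizer A x eta x1 -> near_minimizer A x eta x2 -> `|x1 - x2| < e) ->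
  exists2 p, A p & `|p - x| = dist_to A x.
Proof.
move=> clA A0 close.
have /choice[u u_] (n : nat) : exists y, A y /\ `|y - x| < dist_to A x + n.+1%:R^-1.
  by have [y Ay yx] := @dist_to_adherent _ _ A x n.+1%:R^-1 A0 ltac:(by []); exists y.
have unear (eta : R) : 0 < eta -> \forall n \near \oo, near_minimizer A x eta (u n).
  move=> eta0; near=> n; split; first by case: (u_ n).
  have [_ /ltW/le_trans] := u_ n; apply; rewrite lerD2l ltW//.
  by near: n; exact: near_infty_natSinv_lt (PosNum eta0).
have /cauchy_cvgP/cvg_ex[p up] : cauchy (u @ \oo).
  apply: cauchy_exP => e e0; have [eta eta0 H] := close e e0.
  have /filter_ex [N uN] := unear _ eta0.
  exists (u N); rewrite /fmap/=; near=> n; rewrite -ball_normE /=; apply: H => //.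
  by near: n; exact: unear.
have Ap : A p by apply: (closed_cvg A clA _ p up); near=> n; case: (u_ n).
exists p => //; apply/eqP; rewrite eq_le dist_to_le// andbT.
apply/ler_addgt0Pr => eta eta0.
have cv : (fun n => `|u n - x|) @ \oo --> `|p - x|.
  by apply: cvg_norm; apply: cvgB => //; exact: cvg_cst.
apply: (closed_cvg _ (@closed_le _ (dist_to A x + eta)) _ _ cv).
by near=> n; have [] : near_minimizer A x eta (u n) by near: n; exact: unear.
Unshelve. all: by end_near. Qed.

(** * Radial retraction onto a closed ball *)

Definition radial_retraction {R : realType} {E : normedModType R} (a : E) (r : R) (x : E) : E :=
  a + (r / Num.max r `|x - a|) *: (x - a).

Section RadialRetraction.
Context {R : realType} {E : normedModType R}.
Variables (a : E) (r : R).
Hypothesis r0 : 0 < r.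

Lemma radial_retraction_cball x : cball a r (radial_retraction a r x).
Proof.
rewrite /cball/= /radial_retraction addrAC subrr add0r normrZ.
have m0 : 0 < Num.max r `|x - a| by rewrite lt_max r0.
rewrite ger0_norm ?divr_ge0 ?(ltW r0) ?(ltW m0)// mulrAC ler_pdivrMr//.
by rewrite ler_pM2l// le_max lexx orbT.
Qed.

Lemma radial_retraction_id x : cball a r x -> radial_retraction a r x = x.
Proof.
rewrite /cball/= /radial_retraction => /max_idPl ->.
by rewrite divff ?gt_eqF// scale1r addrC subrK.
Qed.

(** With [Num.max] one formula covers the inside and the outside of the ball, and its denominator is
    at least [r > 0]. *)
Lemma continuous_radial_retraction : continuous (radial_retraction a r).
Proof.
move=> x; apply: cvgD; first exact: cvg_cst.
have cxa : (y - a) @[y --> x] --> (x - a) by apply: cvgB => //; exact: cvg_cst.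
apply: cvgZ => //; apply: cvgM; first exact: cvg_cst.
apply: cvgV; first by rewrite gt_eqF// lt_max r0.
apply: (@continuous_max _ _ (cst r) (fun y => `|y - a|) x); first exact: cvg_cst.
exact: cvg_norm.
Qed.

End RadialRetraction.

Theorem theorem3p4 (R : realType) (E : completeNormedModType R)
  (d : R) (A : set E) (a : E) (r : R) :
  uniformly_convex (E := E) ->
  0 < d ->
  closed A -> A !=set0 ->
  weakly_convex A (2%:R * d) ->
  (forall eps : R, 0 < eps < 2%:R * d ->
     modnonconv A eps < d * modconv (E := E) (eps / d)) ->
  condition_i (fun t => d * modconv (E := E) (t / d)) (modnonconv A) (2%:R * d) ->
  0 < r -> 2%:R * r < d -> A `<=` cball a r ->
  (forall eps : R, 0 < eps < diam A ->
     modnonconv A eps < d * modconv (E := E) (eps / d)) ->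
  exists phi : E -> E,
    [/\ continuous phi, (forall x, A (phi x)) & (forall x, A x -> phi x = x)].
Proof.
move=> _ d0 clA A0 _ gap _ r0 rd Ar _.
have diamball x y : cball a r x -> cball a r y -> `|x - y| <= 2%:R * r.
  rewrite /cball/= => xa ya; have := ler_distD a x y; rewrite (distrC a y); lra.
(* The number [2 r] bounds both the distances between points of [A] and the distance to [A] from any
   point of the ball. *)
have close := @near_minimizers_close _ _ A d (2%:R * r) (2%:R * r) d0 rd
  (fun x y Ax Ay => diamball x y (Ar x Ax) (Ar y Ay))
  (fun e he => gap e ltac:(move: he; lra)).
have dball x : cball a r x -> dist_to A x <= 2%:R * r.
  move=> xa; have [y Ay] := A0; apply: (le_trans (dist_to_le A x y Ay)).
  exact: diamball (Ar y Ay) xa.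
pose rr := radial_retraction a r.
have rrball x : dist_to A (rr x) <= 2%:R * r by apply/dball/radial_retraction_cball.
have /choice[phi phiP] x : exists p, A p /\ `|p - rr x| = dist_to A (rr x).
  have [|p Ap px] := @exists_projection _ _ A (rr x) clA A0; last by exists p.
  move=> e /close[eta eta0 H]; exists eta => // x1 x2; exact: H.
exists phi; split; [|by move=> x; case: (phiP x)|].
  move=> x; apply/cvgrPdist_lt => e /close[eta eta0 H].
  (* The half is due to a double loss: replacing [rr y] by [rr x] changes both the distance to
     [phi y] and the distance to [A]. *)
  have /cvgrPdist_lt/(_ (eta / 2%:R)) := @continuous_radial_retraction _ _ a r r0 x.
  rewrite divr_gt0// => /(_ isT); apply: filterS => y; rewrite -/(rr x) -/(rr y) => xy.
  have [[Ax px] [Ay py]] := (phiP x, phiP y).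
  apply: (H (rr x)) => //; split => //; first by rewrite px; lra.
  have := ler_distD (rr y) (phi y) (rr x); rewrite py (distrC (rr y) (rr x)).
  have := dist_to_lip A (rr y) (rr x) A0; rewrite (distrC (rr y) (rr x)); lra.
move=> x Ax; have [_] := phiP x; rewrite /rr (radial_retraction_id a r r0 x (Ar x Ax)).
have := dist_to_le A x x Ax; rewrite subrr normr0 => dx px.
by apply/eqP; rewrite -subr_eq0 -normr_le0 px.
Qed.
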